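(* Let $\boldsymbol{\mu}=(\mu_1,\ldots,\mu_n)$ be an $n$-tuple of umbral monomials with generating function $f(\boldsymbol{\mu},\boldsymbol{t})$ and let $\boldsymbol{\nu}=(\nu_1,\ldots,\nu_n)$ be an $n$-tuple of umbral monomials with generating function $f(\boldsymbol{\nu},\boldsymbol{t})$, where $\boldsymbol{t}=(t_1,\dots,t_n)$. Then the auxiliary umbra $(\mu_1+\cdots+\mu_n)\boldsymbol{.}\beta\boldsymbol{.}\boldsymbol{\nu}$ has generating function $$f[(\mu_1+\cdots+\mu_n)\boldsymbol{.}\beta\boldsymbol{.}\boldsymbol{\nu},\,\boldsymbol{t}]=f[\boldsymbol{\mu},(f(\boldsymbol{\nu},\boldsymbol{t})-1,\ldots,f(\boldsymbol{\nu},\boldsymbol{t})-1)],$$ an identity of formal power series in $t_1,\dots,t_n$.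
   Context: $R$ is the real or complex field, $A$ is a set (the alphabet) whose elements are called umbrae, and $E:R[A]\to R$ is a linear functional (evaluation) with $E[1]=1$ and $E[\alpha^i\gamma^j\cdots]=E[\alpha^i]E[\gamma^j]\cdots$ for distinct umbrae and nonnegative integers $i,j,\dots$. An $n$-tuple $\boldsymbol{\mu}=(\mu_1,\dots,\mu_n)$ of umbral monomials (monomials in $R[A]$, supports not necessarily disjoint) has multivariate moments $E[\boldsymbol{\mu}^{\boldsymbol{i}}]$, $\boldsymbol{\mu}^{\boldsymbol{i}}=\mu_1^{i_1}\cdots\mu_n^{i_n}$, $\boldsymbol{i}\in\mathbb{N}_0^n$, and generating function $f(\boldsymbol{\mu},\boldsymbol{t})=1+\sum_{\boldsymbol{i}\neq\boldsymbol{0}}E[\boldsymbol{\mu}^{\boldsymbol{i}}]\,\boldsymbol{t}^{\boldsymbol{i}}/\boldsymbol{i}!$ with $\boldsymbol{i}!=i_1!\cdots i_n!$, $\boldsymbol{t}^{\boldsymbol{i}}=t_1^{i_1}\cdots t_n^{i_n}$. For formal power series $s_1,\dots,s_n$ without constant term, $f[\boldsymbol{\mu},(s_1,\dots,s_n)]$ denotes the substitution $t_j\mapsto s_j$ in $f(\boldsymbol{\mu},\boldsymbol{t})$. Partitions of a multi-index: a partition $\boldsymbol{\lambda}$ of $\boldsymbol{i}\in\mathbb{N}_0^n$, written $\boldsymbol{\lambda}\vdash\boldsymbol{i}$, is a matrix of nonnegative integers with $n$ rows, no zero column, columns in lexicographic order, and $r$-th row sum equal to $i_r$ for $r=1,\dots,n$.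 Its number of columns is $l(\boldsymbol{\lambda})$. Writing $\boldsymbol{\lambda}=(\boldsymbol{\lambda}_1^{r_1},\boldsymbol{\lambda}_2^{r_2},\dots)$ when the distinct column $\boldsymbol{\lambda}_j$ occurs $r_j$ times, set $\mathfrak{m}(\boldsymbol{\lambda})!=r_1!r_2!\cdots$ and $\boldsymbol{\lambda}!=\prod_j(\boldsymbol{\lambda}_j!)^{r_j}$ (product of factorials of all entries). With $h_{\boldsymbol{j}}=E[\boldsymbol{\nu}^{\boldsymbol{j}}]$ set $h_{\boldsymbol{\lambda}}=h_{\boldsymbol{\lambda}_1}^{r_1}h_{\boldsymbol{\lambda}_2}^{r_2}\cdots$. The auxiliary umbra $p\boldsymbol{.}\beta\boldsymbol{.}\boldsymbol{\nu}$ ($\beta$ denotes the Bell umbra), for an umbral polynomial $p\in R[A]$ (here $p=\mu_1+\cdots+\mu_n$), is the symbolic tuple defined by its moments $$E[(p\boldsymbol{.}\beta\boldsymbol{.}\boldsymbol{\nu})^{\boldsymbol{i}}]=\sum_{\boldsymbol{\lambda}\vdash\boldsymbol{i}}\frac{\boldsymbol{i}!}{\mathfrak{m}(\boldsymbol{\lambda})!\,\boldsymbol{\lambda}!}\,E[p^{\,l(\boldsymbol{\lambda})}]\,h_{\boldsymbol{\lambda}},$$ and its generating function is $1+\sum_{\boldsymbol{i}\ne\boldsymbol{0}}E[(p\boldsymbol{.}\beta\boldsymbol{.}\boldsymbol{\nu})^{\boldsymbol{i}}]\,\boldsymbol{t}^{\boldsymbol{i}}/\boldsymbol{i}!$. 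*)

(* Defs.v *)
From HB Require Import structures.
From mathcomp Require Import all_boot all_order all_algebra finmap.
From mathcomp Require Import monalg.
(* [mpoly] must come last: its ['X_{1..n}] and [mdeg] (fixed-length
   multi-indices) shadow those of [monalg]. *)
From mathcomp Require Import mpoly.

Set Implicit Arguments.
Unset Strict Implicit.
Unset Printing Implicit Defensive.

Import GRing.Theory.
Local Open Scope ring_scope.

(* R[A]: polynomials over R in the (possibly infinitely many) umbrae of A.
   Monomials are elements of [{cmonom A}], i.e. power products.  Below, R is
   any [numFieldType], the common interface of the real and complex fields. *)
Notation umbral_poly R A := {malg R[{cmonom A}]}.

Section Umbral.
Variables (R : numFieldType) (A : choiceType).

Definition umbra (a : A) : umbral_poly R A := << ucm a >>.

Definition umonom (m : {cmonom A}) : umbral_poly R A := << m >>.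

Definition is_evaluation (E : {scalar umbral_poly R A}) : Prop :=
  E 1 = 1 /\
  forall (s : seq A) (e : A -> nat), uniq s ->
    E (\prod_(a <- s) umbra a ^+ e a) = \prod_(a <- s) E (umbra a ^+ e a).

Definition mmoment (n : nat) (E : {scalar umbral_poly R A})
    (mu : n.-tuple {cmonom A}) (i : 'X_{1..n}) : R :=
  E (\prod_(j < n) umonom (tnth mu j) ^+ i j).

End Umbral.

Definition mseries (R : Type) (n : nat) := 'X_{1..n} -> R.

Section Series.
Variables (R : numFieldType).

Definition mser_one n : mseries R n := fun k => (k == 0%MM)%:R.
Arguments mser_one : clear implicits.

Definition mser_sub n (f g : mseries R n) : mseries R n := fun k => f k - g k.

(* Cauchy product; the degree bound on the two indices is implied by the
   condition and only makes the range a finite type. *)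
Definition mser_mul n (f g : mseries R n) : mseries R n := fun k =>
  \sum_(ij : 'X_{1..n < (mdeg k).+1, (mdeg k).+1} | (ij.1 + ij.2)%MM == k)
    f ij.1 * g ij.2.

Definition mser_exp n (f : mseries R n) (a : nat) : mseries R n :=
  iter a (mser_mul f) (mser_one n).

Definition mser_monom m n (s : 'I_m -> mseries R n) (i : 'X_{1..m}) :
    mseries R n :=
  \big[@mser_mul n / mser_one n]_(j < m) mser_exp (s j) (i j).

(* Substitution t_j |-> s_j, meaningful when the s_j have no constant term:
   then s^i has no term of degree < |i| (see [mser_monom_low]), so only the
   indices with |i| <= |k| contribute to the coefficient of t^k
   (see [mser_substE]). *)
Definition mser_subst m n (f : mseries R m) (s : 'I_m -> mseries R n) :
    mseries R n := fun k =>
  \sum_(i : 'X_{1..m < (mdeg k).+1}) f i * mser_monom s i k.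

Lemma mser_mul_low n (f g : mseries R n) a b :
  (forall k, (mdeg k < a)%N -> f k = 0) ->
  (forall k, (mdeg k < b)%N -> g k = 0) ->
  forall k, (mdeg k < a + b)%N -> mser_mul f g k = 0.
Proof.
move=> hf hg k hk; apply: big1 => -[i j] /= /eqP hij.
have [hi|hi] := ltnP (mdeg i) a; first by rewrite hf // mul0r.
have hd : mdeg k = (mdeg i + mdeg j)%N by rewrite -mdegD hij.
rewrite hg ?mulr0 // -(ltn_add2l a); apply: leq_ltn_trans hk.
by rewrite [leqRHS]hd leq_add2r.
Qed.

Lemma mser_monom_low m n (s : 'I_m -> mseries R n) (i : 'X_{1..m}) k :
  (forall j, s j 0%MM = 0) -> (mdeg k < mdeg i)%N -> mser_monom s i k = 0.
Proof.
move=> s0; rewrite (mdegE i) /mser_monom; move: k.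
apply: (big_rec2 (fun (d : nat) (f : mseries R n) =>
  forall k, (mdeg k < d)%N -> f k = 0)) => // j d f _ hf.
apply: mser_mul_low => //; elim: (i j) => // a IH.
rewrite -add1n; apply: mser_mul_low => // k.
by rewrite ltnS leqn0 mdeg_eq0 => /eqP ->.
Qed.

Lemma mser_substE m n (f : mseries R m) (s : 'I_m -> mseries R n) k b :
  (forall j, s j 0%MM = 0) -> (mdeg k < b)%N ->
  mser_subst f s k = \sum_(i : 'X_{1..m < b}) f i * mser_monom s i k.
Proof.
move=> s0 hb; rewrite /mser_subst.
rewrite [RHS](bigID (fun i : 'X_{1..m < b} => mdeg i < (mdeg k).+1)%N) /=.
rewrite [X in _ + X]big1 ?addr0; last first.
  by move=> i; rewrite -leqNgt => hi; rewrite mser_monom_low ?mulr0.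
rewrite [RHS](reindex_onto
  (fun i : 'X_{1..m < (mdeg k).+1} => BMultinom (leq_trans (bmdeg i) hb))
  (fun i : 'X_{1..m < b} => insubd bm0 (val i))) /=; last first.
  by move=> i hi; apply: val_inj => /=; rewrite val_insubd hi.
apply: eq_bigl => i; rewrite bmdeg /=; apply/esym/eqP/val_inj => /=.
by rewrite val_insubd bmdeg.
Qed.

Definition mfact n (i : 'X_{1..n}) : nat := (\prod_(r < n) (i r)`!)%N.

Definition gen_fun n (h : 'X_{1..n} -> R) : mseries R n := fun i =>
  if i == 0%MM then 1 else h i / (mfact i)%:R.

End Series.

Arguments mser_one {R n} k.

(* A matrix of nonnegative integers with n rows and any number of columns is
   encoded as the list of its columns, each an n-tuple; [seqlexi] carries the
   lexicographic order. *)
Definition is_mpartition n (i : 'X_{1..n}) (lam : seq 'X_{1..n}) : bool :=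
  [&& all (fun c => c != 0%MM) lam,
      sorted (fun c d : 'X_{1..n} => ((c : seqlexi nat) <= (d : seqlexi nat))%O) lam
    & [forall r : 'I_n, (\sum_(c <- lam) c r)%N == i r]].

Record mpartition n (i : 'X_{1..n}) := MPartition {
  mpart_cols :> seq 'X_{1..n};
  _ : is_mpartition i mpart_cols
}.

HB.instance Definition _ n (i : 'X_{1..n}) :=
  [isSub for @mpart_cols n i].
HB.instance Definition _ n (i : 'X_{1..n}) :=
  [Countable of mpartition i by <:].

Lemma mpartition_degP n (i : 'X_{1..n}) (lam : mpartition i) :
  (\sum_(c <- lam) mdeg c)%N = mdeg i.
Proof.
case: lam => lam /= /and3P[_ _ /forallP h].
rewrite mdegE; under eq_bigr do rewrite mdegE.
by rewrite exchange_big; apply: eq_bigr => r _; apply/eqP.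
Qed.

Lemma mpartition_size n (i : 'X_{1..n}) (lam : mpartition i) :
  (size lam <= mdeg i)%N.
Proof.
rewrite -(mpartition_degP lam) -sum1_size.
case: lam => lam /= /and3P[/allP nz _ _].
rewrite big_seq [X in (_ <= X)%N]big_seq; apply: leq_sum => c /nz.
by rewrite -mdeg_eq0 lt0n.
Qed.

Lemma mpartition_col n (i : 'X_{1..n}) (lam : mpartition i) c :
  c \in (lam : seq _) -> (mdeg c <= mdeg i)%N.
Proof. by move=> hc; rewrite -(mpartition_degP lam) (big_rem c) //= leq_addr. Qed.

Definition mpartition_enum n (i : 'X_{1..n}) : seq (mpartition i) :=
  pmap insub (undup [seq map val (t : seq 'X_{1..n < (mdeg i).+1})
    | l <- iota 0 (mdeg i).+1,
      t <- [seq tval t | t <- enum {: l.-tuple 'X_{1..n < (mdeg i).+1}}]]).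

Lemma mpartition_enumP n (i : 'X_{1..n}) :
  Finite.axiom (mpartition_enum i).
Proof.
move=> lam; rewrite count_uniq_mem; last first.
  by rewrite (pmap_uniq (@insubK _ _ _)) ?undup_uniq.
apply/eqP; rewrite eqb1 mem_pmap_sub mem_undup.
pose s : seq 'X_{1..n < (mdeg i).+1} := map (insubd bm0) lam.
have val_s : map val s = lam.
  rewrite -map_comp -[RHS]map_id; apply/eq_in_map => c hc /=.
  by rewrite val_insubd ltnS (mpartition_col hc).
apply/flatten_mapP; exists (size lam).
  by rewrite mem_iota add0n ltnS mpartition_size.
have hs : size s == size lam by rewrite size_map.
apply/mapP; exists s; last by rewrite val_s.
by apply/mapP; exists (Tuple hs); rewrite ?mem_enum.
Qed.

HB.instance Definition _ n (i : 'X_{1..n}) :=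
  isFinite.Build (mpartition i) (@mpartition_enumP n i).

(* [undup lam] lists the distinct columns of lam, and [count_mem c lam] is the
   multiplicity of the column c. *)
Definition mpart_mult_fact n (lam : seq 'X_{1..n}) : nat :=
  (\prod_(c <- undup lam) (count_mem c lam)`!)%N.

Definition mpart_fact n (lam : seq 'X_{1..n}) : nat :=
  (\prod_(c <- undup lam) mfact c ^ count_mem c lam)%N.

Definition mpart_moment (R : numFieldType) n (h : 'X_{1..n} -> R)
    (lam : seq 'X_{1..n}) : R :=
  \prod_(c <- undup lam) h c ^+ count_mem c lam.

Definition bell_moment (R : numFieldType) (A : choiceType) (n : nat)
    (E : {scalar umbral_poly R A}) (p : umbral_poly R A)
    (nu : n.-tuple {cmonom A}) (i : 'X_{1..n}) : R :=
  \sum_(lam : mpartition i)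
    (mfact i)%:R / ((mpart_mult_fact lam)%:R * (mpart_fact lam)%:R)
    * E (p ^+ size lam) * mpart_moment (mmoment E nu) lam.

(* Main.v *)
(* Put g = f(nu, t) - 1.  Substituting the same series g for every variable
   turns t^i into g^|i|, so by the multinomial theorem applied to
   (mu_1 + ... + mu_n)^l the right-hand side is
   sum_l E[(mu_1 + ... + mu_n)^l] / l! * g^l.  The coefficient of t^k in g^l / l!
   is again given by the multinomial theorem, now with one variable per
   multi-index c of degree at most |k|: a family of exponents m_c with
   sum_c m_c c = k is the family of column multiplicities of a partition of k
   of length sum_c m_c = l. *)
Require Import Defs.
From mathcomp Require Import all_boot all_order all_algebra finmap.
From mathcomp Require Import monalg.
From mathcomp Require Import mpoly.

Set Implicit Arguments.
Unset Strict Implicit.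
Unset Printing Implicit Defensive.

Import GRing.Theory.
Local Open Scope ring_scope.

Lemma natr_fact_neq0 (R : numFieldType) m : (m`!%:R : R) != 0.
Proof. by rewrite Num.Theory.pnatr_eq0 -lt0n fact_gt0. Qed.

(** * Divided powers and the multinomial theorem *)

Section DividedPowers.
Variables (R : numFieldType) (S : comAlgType R).

Definition exp_trunc N (x : S) : {poly S} :=
  \poly_(j < N.+1) ((j`!%:R : R)^-1 *: x ^+ j).

(** The binomial theorem divided by l!: both sides are the coefficient of T^l in exp (x T) exp (y T)
    = exp ((x + y) T). *)
Lemma divided_powerD (x y : S) l :
  \sum_(j < l.+1) ((j`!%:R : R)^-1 *: x ^+ j) *
                  (((l - j)%N`!%:R : R)^-1 *: y ^+ (l - j)%N) =
  (l`!%:R : R)^-1 *: (x + y) ^+ l.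
Proof.
rewrite addrC exprDn scaler_sumr; apply: eq_bigr => j _.
have jl : (j <= l)%N by rewrite -ltnS.
rewrite -scalerAl -scalerAr scalerA -scaler_nat scalerA [x ^+ _ * _]mulrC.
congr (_ *: _); rewrite -(bin_fact jl) !natrM.
have bin0 : ('C(l, j)%:R : R) != 0 by rewrite Num.Theory.pnatr_eq0 -lt0n bin_gt0.
by rewrite invfM mulrAC mulVf // mul1r invfM.
Qed.

(* exp_trunc N x is exp (x T) mod T^(N+1), so exp turns the sum into a product. *)
Lemma exp_trunc_sum (I : Type) (r : seq I) (x : I -> S) N l :
  (l <= N)%N ->
  (\prod_(i <- r) exp_trunc N (x i))`_l =
  (l`!%:R : R)^-1 *: (\sum_(i <- r) x i) ^+ l.
Proof.
pose K (p : {poly S}) a :=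
  forall l, (l <= N)%N -> p`_l = (l`!%:R : R)^-1 *: a ^+ l.
move: l; suff: K (\prod_(i <- r) exp_trunc N (x i)) (\sum_(i <- r) x i) by [].
apply: (big_rec2 K) => [[|l] _|i p a _ Kpa l lN].
- by rewrite coef1 expr0 fact0 invr1 scale1r.
- by rewrite coef1 expr0n /= scaler0.
rewrite coefM -divided_powerD; apply: eq_bigr => j _.
have jl : (j <= l)%N by rewrite -ltnS.
rewrite coef_poly ltnS (leq_trans jl lN) Kpa //.
exact: leq_trans (leq_subr _ _) lN.
Qed.

(** The multinomial theorem, obtained by expanding a product of truncated exponentials. The bound
    [N] makes the set of exponent families finite and loses nothing, since exponents of sum [l] are
    at most [l]. *)
Lemma divided_power_sum (I : finType) (x : I -> S) N l :
  (l <= N)%N ->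
  (l`!%:R : R)^-1 *: (\sum_i x i) ^+ l =
  \sum_(m : {ffun I -> 'I_N.+1} | (\sum_i m i)%N == l)
     \prod_i ((m i)`!%:R : R)^-1 *: \prod_i x i ^+ m i.
Proof.
move=> lN; rewrite -(exp_trunc_sum _ _ lN).
under eq_bigr do rewrite /exp_trunc poly_def.
rewrite bigA_distr_bigA coef_sum [RHS]big_mkcond; apply: eq_bigr => m _ /=.
under eq_bigr do rewrite -mul_polyC.
(* The powers of the formal variable multiply to one whose exponent is the sum of the [m i], so the
   coefficient of index [l] selects the families of sum [l]. *)
rewrite big_split /= prodrXr -rmorph_prod /= coefCM coefXn eq_sym.
by case: eqP => _; rewrite ?mulr0 ?mulr1 ?scaler_prod.
Qed.

End DividedPowers.

(** * Comparison of power series with polynomials up to a degree *)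

Section SeriesPolynomials.
Variables (R : numFieldType) (n : nat).
Implicit Types (g : mseries R n) (p : mpoly n R) (d : nat).

(** Series are bare functions; agreement with a polynomial lets identities of the polynomial ring be
    used on their coefficients. *)
Definition agree_upto d p g := forall k, (mdeg k <= d)%N -> p@_k = g k.

Definition series_trunc d g : mpoly n R :=
  \sum_(c : 'X_{1..n < d.+1}) g c *: 'X_[c].

Lemma series_truncP d g : agree_upto d (series_trunc d g) g.
Proof.
move=> k kd; have kd1 : (mdeg k < d.+1)%N by [].
rewrite raddf_sum (bigD1 (BMultinom kd1)) //= mcoeffZ mcoeffX eqxx mulr1.
rewrite big1 ?addr0 // => c ck; rewrite mcoeffZ mcoeffX.
by case: eqP => [ck'|]; rewrite ?mulr0 // -(inj_eq val_inj) /= ck' eqxx in ck *.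
Qed.

Lemma agree_one d : agree_upto d 1 mser_one.
Proof. by move=> k _; rewrite mcoeff1. Qed.

Lemma agree_mul d p q f g :
  agree_upto d p f -> agree_upto d q g -> agree_upto d (p * q) (mser_mul f g).
Proof.
move=> pf qg k kd; rewrite mcoeffM; apply: eq_big => [ij|ij /eqP ijk].
  by rewrite eq_sym.
rewrite ijk mdegD in kd.
by rewrite pf ?qg // (leq_trans _ kd) ?leq_addr ?leq_addl.
Qed.

Lemma agree_exp d p g a :
  agree_upto d p g -> agree_upto d (p ^+ a) (mser_exp g a).
Proof.
move=> pg; elim: a => [|a IH]; first exact: agree_one.
by rewrite exprS; apply: agree_mul.
Qed.

(** With the same series in every variable, a monomial depends on its exponents through their sum
    alone. *)
Lemma agree_monom d m p g (i : 'X_{1..m}) :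
  agree_upto d p g -> agree_upto d (p ^+ mdeg i) (mser_monom (fun=> g) i).
Proof.
move=> pg; rewrite mdegE -prodrXr /mser_monom.
apply: (big_rec2 (agree_upto d)) => [|j q f _]; first exact: agree_one.
by apply: agree_mul; apply: agree_exp.
Qed.

End SeriesPolynomials.

(** * Moments of the sum of the umbral monomials *)

Section Moments.
Variables (R : numFieldType) (A : choiceType) (E : {scalar umbral_poly R A}).

Lemma mmoment0 n (mu : n.-tuple {cmonom A}) : E 1 = 1 -> mmoment E mu 0%MM = 1.
Proof. by move=> E1; rewrite /mmoment big1 // => j _; rewrite mnm0E expr0. Qed.

Lemma gen_funE n (h : 'X_{1..n} -> R) i :
  h 0%MM = 1 -> gen_fun h i = h i / (mfact i)%:R.
Proof.
rewrite /gen_fun; case: eqP => // -> ->; rewrite /mfact big1 ?divr1 // => r _.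
by rewrite mnm0E.
Qed.

Lemma moment_power_sum n (mu : n.-tuple {cmonom A}) N l :
  (l <= N)%N ->
  l`!%:R^-1 * E ((\sum_(j < n) umonom R (tnth mu j)) ^+ l) =
  \sum_(i : 'X_{1..n < N.+1} | mdeg i == l) mmoment E mu i / (mfact i)%:R.
Proof.
move=> lN; rewrite -[LHS]linearZ (divided_power_sum _ lN) linear_sum /=.
rewrite (reindex_onto
  (fun i : 'X_{1..n < N.+1} => [ffun j => inord (i j)] : {ffun 'I_n -> 'I_N.+1})
  (fun m => insubd bm0 [multinom (m j : nat) | j < n])) /=; last first.
  move=> m /eqP ml; apply/ffunP => j; rewrite ffunE val_insubd.
  rewrite mdegE; under eq_bigr do rewrite mnmE.
  by rewrite ml ltnS lN mnmE inord_val.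
have toE (i : 'X_{1..n < N.+1}) j :
    ([ffun j => inord (i j)] : {ffun 'I_n -> 'I_N.+1}) j = i j :> nat.
  rewrite ffunE inordK //; apply: leq_ltn_trans (bmdeg i).
  by rewrite mdegE (bigD1 j) //= leq_addr.
apply: eq_big => [i|i _].
  under eq_bigr do rewrite toE.
  rewrite mdegE andb_idr // => _; apply/eqP/val_inj; rewrite val_insubd.
  set i' := [multinom _ | _ < n].
  have -> : i' = i by apply/mnmP => j; rewrite mnmE toE.
  by rewrite bmdeg.
rewrite linearZ /= mulrC /mfact natr_prod; congr (E _ * _).
  by apply: eq_bigr => j _; rewrite toE.
by rewrite -prodfV; apply: eq_bigr => j _; rewrite toE.
Qed.

End Moments.

(** * Partitions of a multi-index as families of column multiplicities *)

Section Partitions.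
Variables (R : numFieldType) (n : nat).

Lemma mpartition_sum (k : 'X_{1..n}) (lam : mpartition k) :
  (\sum_(c <- lam) c)%MM = k.
Proof.
case: lam => lam /= /and3P[_ _ /forallP sumlam].
by apply/mnmP => r; rewrite mnm_sumE; apply/eqP.
Qed.

Lemma mpartition_nz (k : 'X_{1..n}) (lam : mpartition k) :
  0%MM \notin (lam : seq _).
Proof.
by case: lam => lam /= /and3P[/allP nz _ _]; apply/negP => /nz; rewrite eqxx.
Qed.

(** The lexicographic order is antisymmetric, so a multiset of columns has one sorted listing. *)
Lemma mpartition_perm_eq (k : 'X_{1..n}) (lam rho : mpartition k) :
  perm_eq lam rho -> lam = rho.
Proof.
move=> lr; apply: val_inj.
case: lam rho lr => [lam /= /and3P[_ sl _]] [rho /= /and3P[_ sr _]].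
apply: sorted_eq sl sr.
  by move=> a b c; apply: Order.POrderTheory.le_trans.
by move=> a b /Order.POrderTheory.le_anti ab; do 2!apply: val_inj.
Qed.

(** [inord] would send a count above [d] to 0; in a partition of a multi-index of degree [d], counts
    are bounded by the number of columns, hence by [d]. *)
Definition multiplicities d (s : seq 'X_{1..n}) :
    {ffun 'X_{1..n < d.+1} -> 'I_d.+1} :=
  [ffun c => inord (count_mem (val c) s)].

Section Fixed.
Variable k : 'X_{1..n}.
Let d := mdeg k.
Let T : finType := 'X_{1..n < d.+1}.
Implicit Types (lam : mpartition k) (m : {ffun T -> 'I_d.+1}).

Lemma multiplicitiesE lam (c : T) :
  multiplicities d lam c = count_mem (val c) lam :> nat.
Proof.
rewrite ffunE inordK // ltnS.
exact: leq_trans (count_size _ _) (mpartition_size lam).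
Qed.

Lemma mpartition_lift lam : {s : seq T | map val s = lam}.
Proof.
exists (map (insubd bm0) lam); rewrite -map_comp -[RHS]map_id.
by apply/eq_in_map => c hc /=; rewrite val_insubd ltnS (mpartition_col hc).
Qed.

Lemma count_mem_val (s : seq T) (c : T) :
  count_mem (val c) (map val s) = count_mem c s.
Proof. by rewrite count_map; apply: eq_count => x; rewrite /= (inj_eq val_inj). Qed.

Lemma big_multiplicities (V : Type) (idx : V) (op : Monoid.com_law idx)
    (F : 'X_{1..n} -> nat -> V) lam :
  (forall c, F c 0%N = idx) ->
  \big[op/idx]_(c : T) F c (multiplicities d lam c) =
  \big[op/idx]_(c <- undup lam) F c (count_mem c lam).
Proof.
move=> F0; under eq_bigr do rewrite multiplicitiesE.
have [s <-] := mpartition_lift lam.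
rewrite undup_map_inj; last exact: val_inj.
rewrite big_map [RHS]big_uniq ?undup_uniq //= [RHS]big_mkcond; apply: eq_bigr => c _.
by rewrite mem_undup; case: ifPn => // /count_memPn cs; rewrite count_mem_val cs F0.
Qed.

Lemma multiplicities_inj : injective (fun lam => multiplicities d lam).
Proof.
move=> lam rho /ffunP eqm; apply: mpartition_perm_eq; apply/allP => c _ /=.
have [cd|cd] := ltnP (mdeg c) d.+1.
  have /(congr1 (@nat_of_ord _)) := eqm (BMultinom cd).
  by rewrite !multiplicitiesE => ->.
(* A column of degree above [d] occurs in neither partition. *)
by rewrite !(count_memPn _) //; apply/negP => /mpartition_col; rewrite leqNgt cd.
Qed.

(** This describes the image of [multiplicities]. The entry at the zero multi-index needs its own
    condition, as it does not affect the weighted sum. *)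
Definition mult_support m : bool :=
  (m bm0 == 0%N :> nat) && ((\sum_(c : T) (val c *+ m c))%MM == k).

Lemma multiplicities_support lam : mult_support (multiplicities d lam).
Proof.
rewrite /mult_support multiplicitiesE (count_memPn (mpartition_nz lam)) eqxx /=.
apply/eqP; apply: etrans (mpartition_sum lam).
rewrite (@big_multiplicities _ 0%MM _ (fun c a => (c *+ a)%MM)) //.
exact: big_undup_iterop_count.
Qed.

Lemma multiplicities_size lam :
  (\sum_(c : T) multiplicities d lam c)%N = size lam.
Proof.
rewrite (@big_multiplicities _ 0%N _ (fun=> id)) //.
rewrite -(perm_size (perm_count_undup lam)) size_flatten sumnE !big_map.
by apply: eq_bigr => c _; rewrite size_nseq.
Qed.

Lemma multiplicities_onto m :
  mult_support m -> exists lam, multiplicities d lam = m.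
Proof.
case/andP => /eqP m0 /eqP mk.
(* The partition is rebuilt by listing each [c] with multiplicity [m c], then sorting. *)
pose s := flatten [seq nseq (m c) (val c) | c <- enum T].
pose le (a b : 'X_{1..n}) := ((a : seqlexi nat) <= (b : seqlexi nat))%O.
have cnt (c : T) : count_mem (val c) s = m c.
  rewrite count_flatten -map_comp sumnE big_map big_enum /= (bigD1 c) //=.
  rewrite count_nseq /= eqxx mul1n big1 ?addn0 // => b bc.
  by rewrite count_nseq /= (inj_eq val_inj) (negbTE bc).
have sum_s : (\sum_(c <- s) c)%MM = k.
  rewrite -[RHS]mk big_flatten big_map big_enum /=; apply: eq_bigr => c _.
  by rewrite big_nseq -Monoid.iteropE.
have sP : is_mpartition k (sort le s).
  apply/and3P; split.
  - rewrite all_sort; apply/allP => c cs; apply: contraTneq cs => ->.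
    by apply/count_memPn; rewrite (cnt bm0).
  - by apply: sort_sorted => a b; apply: Order.TotalTheory.le_total.
  - apply/forallP => r.
    rewrite -(congr1 (fun x : 'X_{1..n} => x r) sum_s) mnm_sumE.
    by rewrite (perm_big _ (permEl (perm_sort le s))).
exists (MPartition sP); apply/ffunP => c; apply: ord_inj.
by rewrite multiplicitiesE -cnt /= count_sort.
Qed.

Lemma series_power_coef (g : mseries R n) l :
  g 0%MM = 0 -> (l <= d)%N ->
  l`!%:R^-1 * mser_exp g l k =
  \sum_(lam : mpartition k | size lam == l)
    \prod_(c <- undup lam) (g c ^+ count_mem c lam / (count_mem c lam)`!%:R).
Proof.
(* Truncation at degree [d] keeps the coefficient at [k] and gives a finite sum of monomials in a
   commutative ring. *)
move=> g0 ld; rewrite -(agree_exp l (series_truncP (d := d) g)) //.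
rewrite -mcoeffZ (divided_power_sum _ ld) raddf_sum /=.
pose term m : R := \prod_(c : T) (g c ^+ m c / (m c)`!%:R).
have coefE m : (\prod_(c : T) ((m c)`!%:R)^-1 *:
    \prod_(c : T) (g c *: 'X_[c] : mpoly n R) ^+ m c)@_k =
    if mult_support m then term m else 0.
  under [X in _ *: X]eq_bigr do rewrite exprZn.
  rewrite scaler_prod scalerA mcoeffZ mprodXnE mcoeffX -big_split /=.
  under eq_bigr do rewrite mulrC.
  (* Families that use the zero multi-index vanish because [g] has no constant term. *)
  rewrite -/(term m) /mult_support; case: (eqVneq (m bm0 : nat) 0%N) => [_|m0]; last first.
    by rewrite /term (bigD1 bm0) //= g0 expr0n (negbTE m0) !mul0r.
  by case: eqP; rewrite ?mulr1 ?mulr0.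
under eq_bigr do rewrite coefE.
rewrite -big_mkcondr /=.
pose B := [set lam : mpartition k | size lam == l].
transitivity
  (\sum_(m in [set multiplicities d lam | lam : mpartition k in B]) term m).
  apply: eq_bigl => m; apply/andP/imsetP.
    case=> /eqP sm /multiplicities_onto[lam lm].
    by exists lam; rewrite // inE -multiplicities_size lm sm.
  case=> lam; rewrite inE => /eqP <- ->.
  by rewrite multiplicities_size multiplicities_support.
rewrite big_imset /=; last by move=> ? ? _ _; apply: multiplicities_inj.
apply: eq_big => [lam|lam _]; first by rewrite inE.
rewrite /term (@big_multiplicities _ 1 _ (fun c a => g c ^+ a / a`!%:R)) // => c.
by rewrite fact0 divr1.
Qed.

End Fixed.

End Partitions.

(** * Expansion of the substitution and comparison of coefficients *)

Lemma subst_moment_series (R : numFieldType) (A : choiceType)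
    (E : {scalar umbral_poly R A}) (n : nat) (mu : n.-tuple {cmonom A})
    (g : mseries R n) k :
  E 1 = 1 ->
  mser_subst (gen_fun (mmoment E mu)) (fun _ : 'I_n => g) k =
  \sum_(l < (mdeg k).+1)
    l`!%:R^-1 * E ((\sum_(j < n) umonom R (tnth mu j)) ^+ l) * mser_exp g l k.
Proof.
move=> E1; rewrite /mser_subst (partition_big (fun i : 'X_{1..n < (mdeg k).+1} =>
  Ordinal (bmdeg i)) predT) //=; apply: eq_bigr => l _.
rewrite (moment_power_sum E mu (leq_ord l)) mulr_suml.
apply: eq_big => [i|i /eqP <-]; first by rewrite -(inj_eq val_inj).
rewrite gen_funE ?mmoment0 //; congr (_ * _).
(* Both [mser_monom] and [mser_exp] have at [k] the coefficient of the same power of the truncation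
   of [g]. *)
rewrite -(agree_monom i (series_truncP (d := mdeg k) g)) //.
by rewrite (agree_exp _ (series_truncP g)).
Qed.

Theorem theorem3p3 (R : numFieldType) (A : choiceType)
    (E : {scalar umbral_poly R A}) (hE : is_evaluation E)
    (n : nat) (mu nu : n.-tuple {cmonom A}) :
  gen_fun (bell_moment E (\sum_(j < n) umonom R (tnth mu j)) nu) =1
  mser_subst (gen_fun (mmoment E mu))
             (fun _ : 'I_n => mser_sub (gen_fun (mmoment E nu)) mser_one).
Proof.
move=> k; have [E1 _] := hE; rewrite (subst_moment_series _ _ _ E1).
set p := \sum_(j < n) _; set g := mser_sub _ _.
have g0 : g 0%MM = 0 by rewrite /g /mser_sub /gen_fun /mser_one eqxx subrr.
have gE c : c != 0%MM -> g c = mmoment E nu c / (mfact c)%:R.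
  by move=> c0; rewrite /g /mser_sub /gen_fun /mser_one (negbTE c0) subr0.
(* At [k = 0] the left side is 1 by convention, and on the right the term [l = 0] alone remains. *)
have [->|k0] := eqVneq k 0%MM.
  rewrite /gen_fun eqxx mdeg0 big_ord1 expr0 E1 fact0 invr1 !mul1r.
  by rewrite /mser_exp /= /mser_one eqxx.
rewrite /gen_fun (negbTE k0) /bell_moment mulr_suml.
(* Partitions are grouped by length, to match the sum over powers [l] term by term. *)
rewrite (partition_big (fun lam : mpartition k =>
  Ordinal (mpartition_size lam : (size lam < (mdeg k).+1)%N)) predT) //=.
apply: eq_bigr => l _.
rewrite [_^-1 * _]mulrC -mulrA (series_power_coef g0 (leq_ord l)) mulr_sumr.
apply: eq_big => [lam|lam /eqP <-]; first by rewrite -(inj_eq val_inj).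
have -> :
    \prod_(c <- undup lam) (g c ^+ count_mem c lam / (count_mem c lam)`!%:R) =
    mpart_moment (mmoment E nu) lam /
      ((mpart_mult_fact lam)%:R * (mpart_fact lam)%:R).
  rewrite /mpart_moment /mpart_mult_fact /mpart_fact !natr_prod -big_split /=.
  rewrite -prodf_div big_seq [RHS]big_seq; apply: eq_bigr => c.
  rewrite mem_undup => clam; rewrite gE; last first.
    by apply: contraNneq (mpartition_nz lam) => <-.
  by rewrite expr_div_n natrX [_%:R * _]mulrC invfM mulrA.
(* The factor k! in the moment cancels the k! dividing it in the generating function. *)
have mfact_neq0 : (mfact k)%:R != 0 :> R.
  by rewrite natr_prod; apply/prodf_neq0 => r _; apply: natr_fact_neq0.
by rewrite -!mulrA mulrC -!mulrA mulVf // mulr1 mulrC -mulrA.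
Qed.
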